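(* Let $G$ be a $\sigma$-compact, locally compact abelian group, $(X,G)$ a minimal continuous action and $m\in\mathbb{N}$, $m\geq 2$. The following are equivalent: (1) $(X,G)$ is compactly $m$-sensitive; (2) there exists $\delta>0$ such that for every nonempty open $U\subset X$ there exist $x_1,\dots,x_m\in X$ with $x_1\in U$, $(x_i,x_j)\in Q_2(X,G)$ for all $i,j\in\{1,\dots,m\}$, and $\inf_{g\in G}d(gx_i,gx_j)>\delta$ for all $i\neq j$ in $\{1,\dots,m\}$; (3) $r_c(X,G)\geq m$.
   Context: $G$ acts continuously on a compact metric space $(X,d)$; minimal means every orbit is dense. $(X,G)$ is compactly $m$-sensitive if there exists $\varepsilon>0$ such that for every nonempty open $U\subset X$ and every compact $K\subset G$ there exist $x_1,\dots,x_m\in U$ and $h\in G$ with $Kh\subset\{g\in G: d(gx_i,gx_j)>\varepsilon\ \forall i\neq j\}$. A pair $(x,y)$ is regionally proximal, $(x,y)\in Q_2(X,G)$, if for each $\varepsilon>0$ there exist $x',y'$ with $d(x,x')<\varepsilon$, $d(y,y')<\varepsilon$ and $g\in G$ with $d(gx',gy')<\varepsilon$. A pair $(x,y)$ is proximal if $\inf_{g\in G}d(gx,gy)=0$. $\pi_{eq}\colon X\to X_{eq}$ is the factor map onto the maximal equicontinuous factor. The coincidence rank $r_c(X,G)$ is $\sup\{n\in\mathbb{N}:\exists x_1,\dots,x_n\in\pi_{eq}^{-1}(y)$ with $(x_i,x_j)$ not proximal for all $i\neq j\}$, a quantity independent of $y\in X_{eq}$ for minimal actions. *)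

(* Defs.v *)
From HB Require Import structures.
From mathcomp Require Import all_boot all_order all_algebra.
From mathcomp Require Import all_classical all_reals all_analysis.
Set Implicit Arguments. Unset Strict Implicit. Unset Printing Implicit Defensive.
Import Order.TTheory GRing.Theory Num.Theory.
Local Open Scope classical_set_scope.
Local Open Scope ring_scope.

Definition sigma_compact (T : topologicalType) :=
  exists K : nat -> set T, (forall n, compact (K n)) /\ \bigcup_n K n = [set: T].

Definition metric_for (R : realType) (X : topologicalType) (d : X -> X -> R) :=
  [/\ (forall x y, 0 <= d x y),
      (forall x y, d x y = 0 <-> x = y),
      (forall x y, d x y = d y x),
      (forall x y z, d x z <= d x y + d y z) &
      (forall (x : X) (A : set X),
          nbhs x A <-> exists2 e : R, 0 < e & [set y | d x y < e] `<=` A)].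

Definition continuous_action (G : topologicalZmodType) (X : topologicalType)
    (act : G -> X -> X) :=
  [/\ continuous (fun p : G * X => act p.1 p.2),
      (forall x, act 0 x = x) &
      (forall g h x, act (g + h) x = act g (act h x))].

Definition metric_system (R : realType) (G : topologicalZmodType)
    (X : topologicalType) (d : X -> X -> R) (act : G -> X -> X) :=
  [/\ compact [set: X], metric_for d & continuous_action act].

Definition minimal (G : topologicalZmodType) (X : topologicalType)
    (act : G -> X -> X) :=
  forall x : X, closure (range (fun g => act g x)) = [set: X].

Definition equicontinuous_action (R : realType) (G : topologicalZmodType)
    (X : topologicalType) (d : X -> X -> R) (act : G -> X -> X) :=
  forall e : R, 0 < e -> exists2 del : R, 0 < del &
    forall x y, d x y < del -> forall g, d (act g x) (act g y) < e.

Definition factor_map (G : topologicalZmodType) (X Y : topologicalType)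
    (actX : G -> X -> X) (actY : G -> Y -> Y) (p : X -> Y) :=
  [/\ continuous p, (forall y, exists x, p x = y) &
      (forall g x, p (actX g x) = actY g (p x))].

Definition max_equicontinuous_factor (R : realType) (G : topologicalZmodType)
    (X : topologicalType) (actX : G -> X -> X)
    (Y : topologicalType) (dY : Y -> Y -> R) (actY : G -> Y -> Y) (pi : X -> Y) :=
  [/\ metric_system dY actY, equicontinuous_action dY actY,
      factor_map actX actY pi &
      forall (Z : topologicalType) (dZ : Z -> Z -> R) (actZ : G -> Z -> Z)
             (rho : X -> Z),
        metric_system dZ actZ -> equicontinuous_action dZ actZ ->
        factor_map actX actZ rho ->
        exists psi : Y -> Z, factor_map actY actZ psi /\
                             forall x, rho x = psi (pi x)].

Definition compactly_sensitive (R : realType) (G : topologicalZmodType)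
    (X : topologicalType) (d : X -> X -> R) (act : G -> X -> X) (m : nat) :=
  exists2 eps : R, 0 < eps &
    forall U : set X, open U -> U !=set0 ->
    forall K : set G, compact K ->
    exists (x : nat -> X) (h : G),
      (forall i, (i < m)%N -> U (x i)) /\
      (forall k, K k -> forall i j, (i < m)%N -> (j < m)%N -> i != j ->
         eps < d (act (k + h) (x i)) (act (k + h) (x j))).

Definition regionally_proximal (R : realType) (G : topologicalZmodType)
    (X : topologicalType) (d : X -> X -> R) (act : G -> X -> X) (x y : X) :=
  forall e : R, 0 < e -> exists (x' y' : X) (g : G),
    [/\ d x x' < e, d y y' < e & d (act g x') (act g y') < e].

Definition orbit_inf_dist (R : realType) (G : topologicalZmodType)
    (X : topologicalType) (d : X -> X -> R) (act : G -> X -> X) (x y : X) : R :=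
  inf (range (fun g : G => d (act g x) (act g y))).

Definition proximal (R : realType) (G : topologicalZmodType)
    (X : topologicalType) (d : X -> X -> R) (act : G -> X -> X) (x y : X) :=
  orbit_inf_dist d act x y = 0.

(* the set of n such that the fibre pi^{-1}(y) contains n pairwise
   non-proximal points; the coincidence rank r_c is its supremum *)
Definition coincidence_set (R : realType) (G : topologicalZmodType)
    (X : topologicalType) (d : X -> X -> R) (act : G -> X -> X)
    (Y : Type) (pi : X -> Y) (y : Y) : set nat :=
  [set n | exists x : nat -> X,
     (forall i, (i < n)%N -> pi (x i) = y) /\
     (forall i j, (i < n)%N -> (j < n)%N -> i != j -> ~ proximal d act (x i) (x j))].

(* r_c(X,G) >= m, i.e. sup (coincidence_set y) >= m (sup taken in N u {oo}),
   i.e. some element of the set is >= m; for every y (r_c does not depend on y) *)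
Definition coincidence_rank_ge (R : realType) (G : topologicalZmodType)
    (X : topologicalType) (d : X -> X -> R) (act : G -> X -> X)
    (Y : Type) (pi : X -> Y) (m : nat) :=
  forall y : Y, exists n, (m <= n)%N /\ coincidence_set d act pi y n.

(* Main.v *)
Require Import Defs.
From HB Require Import structures.
From mathcomp Require Import all_boot all_order all_algebra.
From mathcomp Require Import all_classical all_reals all_analysis.
From mathcomp Require Import ring lra zify.
Set Implicit Arguments. Unset Strict Implicit. Unset Printing Implicit Defensive.
Import Order.TTheory GRing.Theory Num.Theory.
Import numFieldNormedType.Exports.
Local Open Scope classical_set_scope.
Local Open Scope ring_scope.

(**
Sensitivity gives (2) by passing to a limit of the separated points [h x_i] along
shrinking open sets and growing compact sets; (2) gives (3) because regionally
proximal points have the same image in an equicontinuous factor, and separation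
survives limits along orbits.

The implication from (3) to (1) amounts to this: if [x_1, ..., x_m] lie in one
fibre of [pi] and [U] is open and nonempty, some [w_i] arbitrarily close to the
[x_i] are brought into [U] by a single group element. Following McMahon, let [O]
be an open invariant subset of [X * X] with sections [O[x]], and let [mu] be the
content on open sets coming from an invariant mean. Then [mu (O[x])] is constant
and [rho x y = mu (O[x]) - mu (O[x] `&` O[y])] is a continuous invariant
pseudometric, hence vanishes on the fibres of [pi]; as [mu] has full support,
[O[x]] and [O[y]] then have the same closure. Since [G] is abelian and orbits are
dense, this exchanges the coordinates of a tuple one by one.
*)

(** * Ultrafilter limits and an invariant mean on bounded functions *)

(** Compactness gives a cluster point, and for an ultrafilter a cluster point is a limit, since a
    set or its complement has its preimage in [F]. *)
Lemma ultra_cvg_compact (I : Type) (F : set_system I) (T : topologicalType)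
    (A : set T) (f : I -> T) :
  UltraFilter F -> compact A -> (forall i, A (f i)) ->
  exists2 x, A x & f @ F --> x.
Proof.
move=> FU cA Af.
have fA : (f @ F) A by apply: (@filterS _ F _ setT) filterT => i _; exact: Af.
have [x [Ax clx]] := cA (f @ F) _ fA.
exists x => // V nV.
have [//|nVF] := in_ultra_setVsetC (f @^-1` V) FU.
by have [z []] := clx (~` V) V nVF nV.
Qed.

Section invariant_mean.
Context (R : realType) (G : zmodType) (X : Type) (act : G -> X -> X).
Hypothesis act0 : forall x, act 0 x = x.
Hypothesis actD : forall g h x, act (g + h) x = act g (act h x).

Definition has_norm_bound (f : X -> R) := exists C, forall x, `|f x| <= C.

Definition cesaro (n : nat) (g : G) (f : X -> R) (x : X) : R :=
  n.+1%:R^-1 * \sum_(i < n.+1) f (act (g *+ i) x).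

Definition cesaros (n : nat) (l : seq G) (f : X -> R) := foldr (cesaro n) f l.

Lemma cesaroD n g f1 f2 :
  cesaro n g (f1 \+ f2) = cesaro n g f1 \+ cesaro n g f2.
Proof. by apply/funext => x; rewrite /cesaro /= big_split mulrDr. Qed.

Lemma cesaro_le n g f1 f2 : (forall x, f1 x <= f2 x) ->
  forall x, cesaro n g f1 x <= cesaro n g f2 x.
Proof.
move=> le12 x; rewrite /cesaro ler_wpM2l ?invr_ge0 ?ler0n//.
by apply: ler_sum => i _.
Qed.

Lemma cesaro_cst n g c : cesaro n g (fun=> c) = fun=> c.
Proof.
apply/funext => x; rewrite /cesaro sumr_const card_ord -[c *+ _]mulr_natl mulrA.
by rewrite mulVf ?mul1r// pnatr_eq0.
Qed.

(** Commutativity of [G] moves [h] past the multiples of [g]. *)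
Lemma cesaro_act n g h f :
  cesaro n g (fun x => f (act h x)) = fun x => cesaro n g f (act h x).
Proof.
apply/funext => x; rewrite /cesaro; congr (_ * _); apply: eq_bigr => i _.
by rewrite -!actD addrC.
Qed.

Lemma cesaro_norm n g f c : (forall x, `|f x| <= c) ->
  forall x, `|cesaro n g f x| <= c.
Proof.
move=> fc x.
have /all_and2[fl fu] : forall y, - c <= f y /\ f y <= c.
  by move=> y; apply/andP; rewrite -ler_norml.
have := cesaro_le n g fl x; have := cesaro_le n g fu x.
by rewrite !cesaro_cst ler_norml => -> ->.
Qed.

Lemma cesaroB n g f1 f2 x :
  cesaro n g (fun y => f1 y - f2 y) x = cesaro n g f1 x - cesaro n g f2 x.
Proof. by rewrite /cesaro -mulrBr -sumrB. Qed.

(** The sums telescope: only the two end terms survive, each at most [c] in absolute value. *)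
Lemma cesaro_shift n g f c : (forall x, `|f x| <= c) ->
  forall x, `|cesaro n g f (act g x) - cesaro n g f x| <= 2 * c / n.+1%:R.
Proof.
move=> fc x; rewrite /cesaro -mulrBr normrM ger0_norm ?invr_ge0// mulrC.
rewrite ler_wpM2r ?invr_ge0//.
rewrite big_ord_recr [X in _ - X]big_ord_recl /=.
have -> : \sum_(i < n) f (act (g *+ i) (act g x))
          = \sum_(i < n) f (act (g *+ bump 0 i) x).
  by apply: eq_bigr => i _; rewrite -actD -mulrSr.
rewrite mulr0n act0 opprD addrACA [X in _ + X]addrC addrA.
set S := \sum_(i < n) _.
have -> : S - f x - S + f (act (g *+ n) (act g x))
          = f (act (g *+ n) (act g x)) - f x by ring.
rewrite (le_trans (ler_normB _ _))//.
by have := fc x; have := fc (act (g *+ n) (act g x)); lra.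
Qed.

Lemma cesarosD n l f1 f2 :
  cesaros n l (f1 \+ f2) = cesaros n l f1 \+ cesaros n l f2.
Proof. by elim: l => //= g l ->; exact: cesaroD. Qed.

Lemma cesaros_le n l f1 f2 : (forall x, f1 x <= f2 x) ->
  forall x, cesaros n l f1 x <= cesaros n l f2 x.
Proof. by move=> ?; elim: l => //= g l ih; exact: cesaro_le. Qed.

Lemma cesaros_cst n l c : cesaros n l (fun=> c) = fun=> c.
Proof. by elim: l => //= g l ->; exact: cesaro_cst. Qed.

Lemma cesaros_act n l h f :
  cesaros n l (fun x => f (act h x)) = fun x => cesaros n l f (act h x).
Proof. by elim: l => //= g l ->; exact: cesaro_act. Qed.

Lemma cesaros_norm n l f c : (forall x, `|f x| <= c) ->
  forall x, `|cesaros n l f x| <= c.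
Proof. by move=> ?; elim: l => //= g l ih; exact: cesaro_norm. Qed.

(** Averages applied before the one along [g] keep the bound [c]; those applied after it commute
    with the translation and do not increase the error. *)
Lemma cesaros_shift n l g f c : (forall x, `|f x| <= c) -> g \in l ->
  forall x, `|cesaros n l f (act g x) - cesaros n l f x| <= 2 * c / n.+1%:R.
Proof.
move=> fc; elim: l => //= h l ih; rewrite inE => /predU1P[<-|gl] x.
  exact/cesaro_shift/cesaros_norm.
have -> : cesaro n h (cesaros n l f) (act g x)
          = cesaro n h (fun y => cesaros n l f (act g y)) x by rewrite cesaro_act.
by rewrite -cesaroB; apply: cesaro_norm => y; exact: ih.
Qed.

(** The mean is the limit of iterated averages at [x0] as the list of directions and the length
    grow. Each [g] eventually enters the list, so [cesaros_shift] makes the limit invariant. *)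
Lemma invariant_mean (x0 : X) : exists L : (X -> R) -> R,
  [/\ forall f g, has_norm_bound f -> has_norm_bound g -> L (f \+ g) = L f + L g,
      forall f g, has_norm_bound f -> has_norm_bound g -> (forall x, f x <= g x) ->
        L f <= L g,
      forall c, L (fun=> c) = c &
      forall g f, has_norm_bound f -> L (fun x => f (act g x)) = L f].
Proof.
pose B (s : seq G * nat) :=
  [set p : seq G * nat | {subset s.1 <= p.1} /\ (s.2 <= p.2)%N].
have FF : ProperFilter (filter_from setT B).
  apply: filter_from_proper; last first.
    by move=> s _; exists s; split.
  apply: filter_from_filter; first by exists ([::], 0%N).
  move=> [s n] [s' n'] _ _; exists (s ++ s', maxn n n') => // -[t k] [/= st].
  rewrite geq_max => /andP[nk nk'].
  by split; split => //= g gs; apply: st; rewrite mem_cat gs ?orbT.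
have [U [UU FU]] := ultraFilterLemma FF.
pose E f (p : seq G * nat) := cesaros p.2 p.1 f x0.
(* The default [0] is taken only when [E f] has no limit along [U], which never happens for bounded
   [f]. *)
pose L f := xget 0 [set r : R | E f @ U --> r].
have EL f : has_norm_bound f -> E f @ U --> L f.
  move=> [c fc].
  have [r _ fr] : exists2 r, `[- c, c]%classic r & E f @ U --> r.
    have cc := @segment_compact R (- c) c.
    apply: (ultra_cvg_compact (f := E f) UU cc) => p.
    by rewrite /= in_itv /= -ler_norml; exact: cesaros_norm.
  by rewrite /L; case: xgetP => [y _|/(_ r)].
have LU f r : E f @ U --> r -> L f = r.
  move=> fr; rewrite /L; case: xgetP => [y _ /= fy|/(_ r)//].
  exact: (cvg_unique (@norm_hausdorff _ R^o) fy fr).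
exists L; split.
- move=> f g bf bg; apply: LU.
  have -> : E (f \+ g) = E f \+ E g.
    by apply/funext => p; rewrite /E cesarosD.
  by apply: cvgD; exact: EL.
- move=> f g bf bg fg.
  have [//|ltfg] := leP (L f) (L g).
  pose r := (L f + L g) / 2.
  have Uf : \forall p \near U, r < E f p.
    by apply: cvgr_gt (EL _ bf) _ _; rewrite /r; lra.
  have Ug : \forall p \near U, E g p < r.
    by apply: cvgr_lt (EL _ bg) _ _; rewrite /r; lra.
  have [p [rf gr]] := filter_ex (filterI Uf Ug).
  by have := cesaros_le p.2 p.1 fg x0; move: rf gr; rewrite /E; lra.
- move=> c; apply: LU.
  have -> : E (fun=> c) = fun=> c by apply/funext => p; rewrite /E cesaros_cst.
  exact: cvg_cst.
- move=> g f bf; apply: LU.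
  have -> : E (fun x => f (act g x))
      = E f \+ (fun p => cesaros p.2 p.1 f (act g x0) - E f p).
    by apply/funext => p; rewrite /E cesaros_act /= addrC subrK.
  rewrite -[L f]addr0; apply: cvgD; first exact: EL.
  have [c fc] := bf.
  have c0 : 0 <= c by rewrite (le_trans _ (fc x0)).
  apply/cvgr0Pnorm_lt => e e0.
  (* With this [N], the error [2 * c / n.+1] is below [e] as soon as [N <= n]. *)
  pose N := Num.truncn (2 * c / e).
  apply: FU; exists ([:: g], N) => // -[l n] [/= gl Nn].
  rewrite (le_lt_trans (cesaros_shift n fc _ x0))//.
    by apply: gl; rewrite inE.
  rewrite ltr_pdivrMr// -ltr_pdivrMl// mulrC.
  rewrite (lt_le_trans (truncnS_gt _))//.
  by rewrite ler_nat ltnS.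
Qed.

End invariant_mean.

(** * Metrics inducing a given topology *)

Section metric.
Context (R : realType) (X : topologicalType) (d : X -> X -> R).
Hypothesis dM : metric_for d.

Lemma metric_refl x : d x x = 0.
Proof. by have [_ d0 _ _ _] := dM; apply/d0. Qed.

Lemma metric_nbhs x e : 0 < e -> nbhs x [set y | d x y < e].
Proof. by move=> e0; have [_ _ _ _ dn] := dM; apply/dn; exists e. Qed.

Lemma metric_nbhsP x (A : set X) : nbhs x A ->
  exists2 e, 0 < e & forall y, d x y < e -> A y.
Proof.
have [_ _ _ _ dn] := dM.
by move=> /dn[e e0 eA]; exists e => // y ?; exact: eA.
Qed.

Lemma metric_continuous z : continuous (d z : X -> R).
Proof.
have [d0 _ dC dT _] := dM.
move=> x; apply/cvgrPdist_lt => e e0.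
apply: filterS (metric_nbhs x e0) => y /= xy.
have := dT z x y; have := dT z y x; rewrite (dC y x) => h1 h2.
by rewrite ltr_norml; lra.
Qed.

Lemma metric_for_hausdorff : hausdorff_space X.
Proof.
have [d0 dE dC dT _] := dM.
move=> x y cxy; apply/dE/eqP; rewrite eq_le d0 andbT leNgt; apply/negP => xy.
have e0 : 0 < d x y / 2 by lra.
have [z [/= xz yz]] := cxy _ _ (metric_nbhs x e0) (metric_nbhs y e0).
by have := dT x z y; rewrite (dC z y); lra.
Qed.

End metric.

Lemma bounded_continuous (R : realType) (X : topologicalType) (f : X -> R) :
  compact [set: X] -> continuous f -> has_norm_bound f.
Proof.
move=> cX cf.
have : compact (f @` setT).
  by apply: continuous_compact => //; exact: continuous_subspaceT.
move=> /compact_bounded/pinfty_ex_gt0[M M0 MP]; exists M => x.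
by apply: MP; exists x.
Qed.

(** * Minimal actions on compact spaces *)

Section minimal_system.
Context (G : topologicalZmodType) (X : topologicalType) (act : G -> X -> X).
Hypothesis aC : continuous_action act.

Lemma act_continuous g : continuous (act g).
Proof.
have [ca _ _] := aC; move=> x.
by apply: (@cvg_comp _ _ _ (pair g) (fun p : G * X => act p.1 p.2) (nbhs x)
             (nbhs (g, x)));
  [apply: cvg_pair; [exact: cvg_cst|exact: cvg_id]|exact: (ca (g, x))].
Qed.

Lemma actK g x : act (- g) (act g x) = x.
Proof. by have [_ a0 aD] := aC; rewrite -aD addNr a0. Qed.

Lemma actKV g x : act g (act (- g) x) = x.
Proof. by have [_ a0 aD] := aC; rewrite -aD addrN a0. Qed.

Hypothesis aM : minimal act.

Lemma minimal_hit x (U : set X) : open U -> U !=set0 ->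
  exists g, U (act g x).
Proof.
move=> oU [y Uy].
have : closure (range (fun g => act g x)) y by rewrite aM.
by move=> /(_ U (open_nbhs_nbhs (conj oU Uy)))[_ [[g _ <-] ?]]; exists g.
Qed.

(** Preimages of [U] under group elements cover [X]. Compactness is used as near covering along the
    filter of finite lists ordered by inclusion. *)
Lemma minimal_finite_hit (U : set X) : compact [set: X] -> open U ->
  U !=set0 -> exists l : seq G, forall x, exists2 g, g \in l & U (act g x).
Proof.
move=> /compact_near_coveringP cX oU U0.
pose F := filter_from setT (fun s : seq G => [set l : seq G | {subset s <= l}]).
have FF : ProperFilter F.
  apply: filter_from_proper; last by move=> s _; exists s.
  apply: filter_from_filter; first by exists [::].
  move=> s s' _ _; exists (s ++ s') => // l sl.
  by split => g gs; apply: sl; rewrite mem_cat gs ?orbT.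
have lF : \forall l \near F, [set: X] `<=` fun x => exists2 g, g \in l & U (act g x).
  apply: cX => x _; have [g Ug] := minimal_hit x oU U0.
  exists (act g @^-1` U, [set l : seq G | g \in l]) => [|[x' l] [/= ? ?]]; last by exists g.
  split => /=.
    by apply: act_continuous; exact: open_nbhs_nbhs.
  by exists [:: g] => // l sl; apply: sl; rewrite mem_head.
by have [l lP] := @filter_ex _ F FF _ lF; exists l => x; exact: lP.
Qed.

End minimal_system.

(** * The invariant content of a mean *)

Section content.
Context (R : realType) (G : topologicalZmodType) (X : topologicalType)
  (act : G -> X -> X).
Hypothesis cX : compact [set: X].
Hypothesis aC : continuous_action act.
Hypothesis aM : minimal act.
Context (L : (X -> R) -> R).
Hypothesis LD : forall f g, has_norm_bound f -> has_norm_bound g ->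
  L (f \+ g) = L f + L g.
Hypothesis Lle : forall f g, has_norm_bound f -> has_norm_bound g ->
  (forall x, f x <= g x) -> L f <= L g.
Hypothesis Lcst : forall c, L (fun=> c) = c.
Hypothesis Lact : forall g f, has_norm_bound f -> L (fun x => f (act g x)) = L f.

Let cbnd (f : X -> R) : continuous f -> has_norm_bound f.
Proof. exact: bounded_continuous. Qed.

(** This is full support: finitely many translates of [f] sum to at least [f z / 2] everywhere, and
    each has mean [L f]. *)
Lemma mean_gt0 (f : X -> R) z : continuous f -> (forall x, 0 <= f x) ->
  0 < f z -> 0 < L f.
Proof.
move=> cf f0 fz.
have [||l lP] := minimal_finite_hit aC aM cX (U := f @^-1` [set r | f z / 2 < r]).
- by apply: open_comp => [x _|]; [exact: cf|exact: open_gt].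
- by exists z => /=; lra.
have cfa g : continuous (fun x => f (act g x)).
  move=> x; apply: (@cvg_comp _ _ _ (act g) f) (cf _).
  exact: act_continuous.
have [cS LS] : continuous (fun x => \sum_(g <- l) f (act g x)) /\
    L (fun x => \sum_(g <- l) f (act g x)) = (size l)%:R * L f.
  elim: l {lP} => [|g l [cS LS]].
    split; first by under eq_fun do rewrite big_nil; exact: cst_continuous.
    by under eq_fun do rewrite big_nil; rewrite Lcst mul0r.
  under eq_fun do rewrite big_cons; split.
    by move=> x; apply: cvgD; [exact: cfa|exact: cS].
  rewrite [LHS](LD (cbnd (cfa g)) (cbnd cS)) LS Lact /=; last exact: cbnd.
  by rewrite -natr1; ring.
have : f z / 2 <= (size l)%:R * L f.
  rewrite -LS -[leLHS]Lcst; apply: Lle => [||x].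
  - exact/cbnd/cst_continuous.
  - exact: cbnd.
  have [g gl /= /ltW fg] := lP x.
  rewrite (le_trans fg)// (big_rem g)//= lerDl.
  by apply: sumr_ge0.
have : 0 <= L f.
  by rewrite -[leLHS]Lcst; apply: Lle => //; [exact/cbnd/cst_continuous|exact: cbnd].
rewrite le_eqVlt => /predU1P[<-|//]; rewrite mulr0; lra.
Qed.

(* [content] plays the role of an invariant regular measure on open sets. Only
   monotonicity and supermodularity are needed, and these hold for inner
   approximation by continuous functions without any countable additivity. *)
Definition below (A : set X) (f : X -> R) :=
  [/\ continuous f, forall x, f x <= 1 & forall x, ~ A x -> f x <= 0].

Definition content (A : set X) : R := sup [set L f | f in below A].

Let content_has_sup A : has_sup [set L f | f in below A].
Proof.
split; first by exists (L (fun=> 0)), (fun=> 0) => //; split=> //; exact: cst_continuous.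
exists 1 => _ [f [cf f1 _] <-]; rewrite -[leRHS]Lcst; apply: Lle => //.
  exact: cbnd.
exact/cbnd/cst_continuous.
Qed.

Lemma content_ge A f : below A f -> L f <= content A.
Proof.
by move=> fA; apply: ub_le_sup; [have [] := content_has_sup A|exists f].
Qed.

Lemma content_approx A e : 0 < e -> exists2 f, below A f & content A - e < L f.
Proof.
move=> e0; have [_ [f fA <-] ?] := sup_adherent e0 (content_has_sup A).
by exists f.
Qed.

Lemma content_le A c : (forall f, below A f -> L f <= c) -> content A <= c.
Proof.
move=> h; apply: ge_sup; first by have [] := content_has_sup A.
by move=> _ [f fA <-]; exact: h.
Qed.

Lemma le_content A B : A `<=` B -> content A <= content B.
Proof.
move=> AB; apply: content_le => f [cf f1 f0].
by apply: content_ge; split=> // x nBx; apply: f0 => /AB.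
Qed.

Lemma content_act g A : content [set x | A (act g x)] = content A.
Proof.
(* One inequality for all [h] and [B] suffices, as applying it to [- g] gives the converse. *)
have le h B : content B <= content [set x | B (act h x)].
  apply: content_le => f [cf f1 f0].
  rewrite -(Lact h (cbnd cf)); apply: content_ge; split => //.
    move=> x; apply: (@cvg_comp _ _ _ (act h) f) (cf _).
    exact: act_continuous.
  by move=> x /= nB; exact: f0.
apply/eqP; rewrite eq_le le andbT (le_trans (le (- g) _))// le_content// => x /=.
by rewrite actKV.
Qed.

(** For [f] below [A] and [B], and [g] below [B] and [C], the maximum is below [B], the minimum is
    below [A] and [C], and the two have sum [f + g]. *)
Lemma content_setI_triangle A B C :
  content (A `&` B) + content (B `&` C) <= content B + content (A `&` C).
Proof.
rewrite -lerBrDr; apply: content_le => f [cf f1 f0].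
rewrite lerBrDr -lerBrDl; apply: content_le => g [cg g1 g0]; rewrite lerBrDl.
have cmx : continuous (fun x => Num.max (f x) (g x)).
  by move=> x; apply: continuous_max; [exact: cf|exact: cg].
have cmn : continuous (fun x => Num.min (f x) (g x)).
  by move=> x; apply: continuous_min; [exact: cf|exact: cg].
rewrite -(LD (cbnd cf) (cbnd cg)).
have -> : f \+ g = (fun x => Num.max (f x) (g x)) \+ (fun x => Num.min (f x) (g x)).
  by apply/funext => x /=; rewrite addr_max_min.
rewrite (LD (cbnd cmx) (cbnd cmn)); apply: lerD; apply: content_ge; split => //.
- by move=> x; rewrite ge_max f1 g1.
- by move=> x nB; rewrite ge_max f0 ?g0// => -[].
- by move=> x; rewrite ge_min f1.
- move=> x nAC; rewrite ge_min.
  have [Ax|nA] := pselect (A x); last by rewrite f0// => -[].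
  by rewrite g0 ?orbT// => -[_ Cx]; exact: nAC.
Qed.

(** A bump [b] supported in [V] has positive mean and can be added to any [f] below [B] without
    leaving the functions below [A], because [f] is nonpositive on [V]. *)
Lemma content_gap (d : X -> X -> R) (A B V : set X) (z : X) :
  metric_for d ->
  nbhs z V -> V `<=` A -> B `<=` A -> V `&` B = set0 -> content B < content A.
Proof.
move=> dM /(metric_nbhsP dM)[e e0 eV] VA BA VB.
pose b x : R := Num.max (1 - d z x / e) 0.
have cb : continuous b.
  move=> x; apply: (@continuous_max _ _ (fun x => 1 - d z x / e) (fun=> 0));
    last exact: cst_continuous.
  apply: cvgB; first exact: cst_continuous.
  by apply: cvgMl; exact: metric_continuous.
have Vb x : ~ V x -> b x = 0.
  move=> nV; apply/max_idPr; rewrite subr_le0 ler_pdivlMr// mul1r leNgt.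
  by apply/negP => /eV.
have d0 x : 0 <= d z x by have [] := dM.
have b1 x : b x <= 1.
  by rewrite ge_max ler01 andbT gerBl divr_ge0// ltW.
have Lb : 0 < L b.
  apply: (mean_gt0 (z := z)) => // [x|]; first by rewrite le_max lexx orbT.
  by rewrite /b (metric_refl dM) mul0r subr0 lt_max ltr01.
suff : content B <= content A - L b by lra.
apply: content_le => f [cf f1 f0]; rewrite lerBrDr -(LD (cbnd cf) (cbnd cb)).
have nVB x : V x -> ~ B x.
  by move=> Vx Bx; have : (V `&` B) x by []; rewrite VB.
apply: content_ge; split.
- by move=> x; apply: cvgD; [exact: cf|exact: cb].
- move=> x /=; have [/nVB/f0 fx|/Vb ->] := pselect (V x); last by rewrite addr0.
  by have := b1 x; lra.
- by move=> x nA /=; rewrite Vb ?addr0 ?f0//; [move=> /BA|move=> /VA].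
Qed.

(** * The pseudometric of an invariant open relation *)

Section pseudometric.
Variables (O : set (X * X)).
Hypothesis oO : open O.
Hypothesis Oact : forall g x z, O (x, z) -> O (act g x, act g z).

Let sec (x : X) := [set z | O (x, z)].

(** A tube argument: where [f] exceeds [e] the point lies in [sec x], and by openness of [O] and
    compactness all such points remain in [sec x'] for [x'] near [x]. *)
Lemma near_section_below x f e : 0 < e -> below (sec x) f ->
  \forall x' \near x, below (sec x `&` sec x') (fun z => f z - e).
Proof.
move=> e0 [cf f1 f0].
have near_z : \forall x' \near x, [set: X] `<=` fun z => O (x', z) \/ f z <= e.
  have /compact_near_coveringP cX' := cX.
  apply: (cX' X (nbhs x) (fun x' z => O (x', z) \/ f z <= e)) => z _.
  have [fze|efz] := ltP (f z) e.
    have nfz : nbhs z [set z' | f z' < e] by exact: cvgr_lt (cf z) _ fze.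
    by exists ([set z' | f z' < e], setT) => [|[z' x'] [/= /ltW ? _]]; 
      [split => //; exact: filterT|right].
  have Oxz : O (x, z) by apply: contrapT => /f0; lra.
  have : nbhs (x, z) O by exact: open_nbhs_nbhs.
  by move=> [[P Q] [/= nP nQ] PQ]; exists (Q, P) => // -[z' x'] [/= ? ?]; left; exact: PQ.
apply: filterS near_z => x' h; split.
- by move=> z; apply: cvgB; [exact: cf|exact: cst_continuous].
- by move=> z; have := f1 z; lra.
- move=> z nO; have [Oz|fz] := h z I; last by lra.
  by have := f0 z (fun Oxz => nO (conj Oxz Oz)); lra.
Qed.

Lemma near_section_content x e : 0 < e ->
  \forall x' \near x, content (sec x) - content (sec x `&` sec x') < e.
Proof.
move=> e0; have e2 : 0 < e / 2 by lra.
have [f fO fL] := content_approx (sec x) e2.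
apply: filterS (near_section_below e2 fO) => x' /content_ge.
have cf : has_norm_bound f by have [cf _ _] := fO; exact: cbnd.
rewrite [X in X <= _](LD cf (cbnd (@cst_continuous _ _ (- (e / 2))))) Lcst; lra.
Qed.

Lemma content_section x y : content (sec x) = content (sec y).
Proof.
suff le x' y' : content (sec x') <= content (sec y').
  by apply/eqP; rewrite eq_le !le.
rewrite leNgt; apply/negP => lt_yx.
have e0 : 0 < content (sec x') - content (sec y') by lra.
(* The orbit of [y'] reaches a point whose section meets [sec x'] in content larger than that of
   [sec y'], although content of sections is constant along orbits. *)
have [|g gP] := minimal_hit aM y' (open_interior
  [set z | content (sec x') - content (sec x' `&` sec z)
           < content (sec x') - content (sec y')]).
  by exists x'; exact: near_section_content.
have := interior_subset gP => /=.
have : content (sec x' `&` sec (act g y')) <= content (sec (act g y')).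
  by apply: le_content => z [].
rewrite -(content_act g (sec (act g y'))).
have -> : [set z | sec (act g y') (act g z)] = sec y'.
  apply/seteqP; split => z /=; rewrite /sec /=; last exact: Oact.
  by move=> /(Oact (- g)); rewrite !actK.
lra.
Qed.

(* [x |-> content (sec x)] is invariant and lower semicontinuous, hence constant by
   minimality; so [content (sec x) - content (sec x `&` sec y)] is symmetric, and
   inner approximation makes it small for [y] close to [x]. *)
Lemma section_pseudometric (d : X -> X -> R) : metric_for d ->
  exists rho : X -> X -> R,
  [/\ forall x y, 0 <= rho x y /\ rho x x = 0,
      forall x y, rho x y = rho y x,
      forall x y z, rho x z <= rho x y + rho y z,
      forall g x y, rho (act g x) (act g y) = rho x y &
      (forall x e, 0 < e -> \forall y \near x, rho x y < e) /\
      forall x y z V, rho x y = 0 -> O (x, z) -> nbhs z V ->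
        exists2 z', V z' & O (y, z')].
Proof.
move=> dM; exists (fun x y => content (sec x) - content (sec x `&` sec y)); split.
- move=> x y; rewrite setIid subrr subr_ge0; split=> //.
  by apply: le_content => z [].
- by move=> x y; rewrite (content_section x y) setIC.
- move=> x y z; have := content_setI_triangle (sec x) (sec y) (sec z).
  by rewrite (content_section x y); lra.
- move=> g x y; rewrite (content_section (act g x) x); congr (_ - _).
  rewrite -(content_act g); congr content; apply/seteqP.
  split => z /=; rewrite /sec /=; last by move=> [? ?]; split; exact: Oact.
  by move=> [/(Oact (- g)) + /(Oact (- g))]; rewrite !actK.
- split; first exact: near_section_content.
  move=> x y z V rho0 Oxz nV; apply: contrapT => nV'.
  have nOx : nbhs z (V `&` sec x).
    apply: filterI nV _; have : nbhs (x, z) O by exact: open_nbhs_nbhs.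
    move=> [[P Q] [/= nP nQ] PQ]; apply: filterS nQ => z' Qz'.
    by apply: PQ; split => //=; exact: nbhs_singleton.
  (* If [V] missed [sec y], the part of [V] in [sec x] would create a gap and make [rho x y]
     positive. *)
  have VO0 : (V `&` sec x) `&` (sec x `&` sec y) = set0.
    by apply/seteqP; split => // z' [[Vz' _] [_ Oy]]; apply: nV'; exists z'.
  have := content_gap dM nOx (@subIsetr _ _ _) (@subIsetl _ _ _) VO0.
  lra.
Qed.

End pseudometric.
End content.

(** * The equicontinuous factor of an invariant pseudometric *)

(* [X / (rho = 0)] is an equicontinuous factor, so the maximal one dominates it. *)
Section pseudometric_quotient.
Local Open Scope quotient_scope.
Context (R : realType) (G : topologicalZmodType) (X : topologicalType)
  (act : G -> X -> X) (rho : X -> X -> R).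
Hypothesis cX : compact [set: X].
Hypothesis aC : continuous_action act.
Hypothesis rho0 : forall x y, 0 <= rho x y /\ rho x x = 0.
Hypothesis rhoC : forall x y, rho x y = rho y x.
Hypothesis rhoT : forall x y z, rho x z <= rho x y + rho y z.
Hypothesis rhoA : forall g x y, rho (act g x) (act g y) = rho x y.
Hypothesis rho_near : forall x e, 0 < e -> \forall y \near x, rho x y < e.

Let rel0 x y : bool := `[< rho x y = 0 >].

Let rel0_refl : reflexive rel0.
Proof. by move=> x; apply/asboolP; have [] := rho0 x x. Qed.

Let rel0_sym : symmetric rel0.
Proof. by move=> x y; rewrite /rel0 rhoC. Qed.

Let rel0_trans : transitive rel0.
Proof.
move=> y x z /asboolP xy /asboolP yz; apply/asboolP.
by have := rhoT x y z; have [] := rho0 x z; lra.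
Qed.

Let rel0E := EquivRel rel0 rel0_refl rel0_sym rel0_trans.

Let Z : topologicalType := quotient_topology {eq_quot rel0E}.

Let p (x : X) : Z := (\pi_({eq_quot rel0E}) x).
Let r (u : Z) : X := repr (u : {eq_quot rel0E}).

Let rK u : p (r u) = u. Proof. exact: reprK. Qed.

Let pE x y : p x = p y <-> rho x y = 0.
Proof.
split; first by move=> /eqquotP /asboolP.
by move=> xy; apply/eqquotP/asboolP.
Qed.

Let rp x : rho (r (p x)) x = 0. Proof. by apply/pE; rewrite rK. Qed.

Let dZ (u v : Z) : R := rho (r u) (r v).
Let actZ (g : G) (u : Z) : Z := p (act g (r u)).

Let dZp u x : dZ u (p x) = rho (r u) x.
Proof.
have := rhoT (r u) (r (p x)) x; have := rhoT (r u) x (r (p x)).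
by rewrite (rhoC x) rp /dZ; lra.
Qed.

Let rhop x y : rho (r (p x)) y = rho x y.
Proof.
have := rhoT (r (p x)) x y; have := rhoT x (r (p x)) y.
by rewrite (rhoC x (r _)) rp; lra.
Qed.

Let actZp g x : actZ g (p x) = p (act g x).
Proof. by apply/pE; rewrite rhoA rp. Qed.

Let p_continuous : continuous p. Proof. exact: pi_continuous. Qed.

Let dZ_metric : metric_for dZ.
Proof.
split.
- by move=> u v; have [] := rho0 (r u) (r v).
- move=> u v; split=> [/pE|->]; first by rewrite !rK.
  by have [] := rho0 (r v) (r v).
- by move=> u v; exact: rhoC.
- by move=> u v w; exact: rhoT.
move=> u A; split; last first.
  move=> [e e0 eA]; apply: filterS eA _; rewrite nbhsE /=.
  exists [set v | dZ u v < e] => //; split; last first.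
    by rewrite /= /dZ; have [_ ->] := rho0 (r u) (r u).
  rewrite /open /= /quotient_open openE => x /=.
  rewrite -/(p x) dZp => xe; rewrite /interior.
  have e'0 : 0 < e - rho (r u) x by lra.
  apply: filterS (rho_near x e'0) => y /=; rewrite -/(p y) dZp.
  by have := rhoT (r u) x y; lra.
rewrite nbhsE => -[B [oB Bu] BA].
(* The quotient topology is not finer than [dZ]: compactness of [X] yields one radius [e] whose ball
   around [u] lies in [B]. *)
have : \forall e \near 0^'+, [set: X] `<=` fun x => rho (r u) x < e -> B (p x).
  have /compact_near_coveringP cX' := cX; apply: cX' => x _.
  have [Bx|nBx] := pselect (B (p x)).
    exists (p @^-1` B, setT) => [|[x' e] [/= Bx' _] _ //]; split; last exact: filterT.
    by apply: p_continuous; exact: open_nbhs_nbhs.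
  have rux : 0 < rho (r u) x / 2.
    have [+ _] := rho0 (r u) x; rewrite le_eqVlt => /predU1P[rux|]; last by lra.
    by case: nBx; have /pE <- := esym rux; rewrite rK.
  (* Here [p x] is outside [B], so [rho (r u) x] is positive; for nearby points and small [e] the
     premise then fails. *)
  exists ([set y | rho x y < rho (r u) x / 2], [set e : R | e < rho (r u) x / 2]).
    by split; [exact: rho_near|exact: nbhs_right_lt].
  move=> [x' e] /= [xx' le] ux'.
  by have := rhoT (r u) x' x; rewrite (rhoC x'); lra.
move=> uB.
have [e [e0 eB]] := filter_ex (filterI (nbhs_right_gt (0 : R)) uB).
by exists e => // v /= uv; apply: BA; rewrite -(rK v); exact: eB.
Qed.

Lemma pseudometric_factor : exists (Z : topologicalType) (dZ : Z -> Z -> R)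
    (actZ : G -> Z -> Z) (p : X -> Z),
  [/\ metric_system dZ actZ, equicontinuous_action dZ actZ,
      factor_map act actZ p & forall x y, p x = p y -> rho x y = 0].
Proof.
have [ca a0 aD] := aC.
exists Z, dZ, actZ, p; split; last by move=> x y /pE.
- split => //.
    have -> : [set: Z] = p @` setT.
      by apply/seteqP; split => // u _; exists (r u).
    by apply: continuous_compact => //; exact: continuous_subspaceT.
  split.
  (* The error splits in two: moving [g] at the fixed point [r u] is controlled by continuity of the
     action, and moving [u] costs [dZ u v] by invariance. *)
  + move=> [g u] W /=; rewrite -(rK u) actZp => /(metric_nbhsP dZ_metric)[e e0 eW].
    have e2 : 0 < e / 2 by lra.
    have ng : nbhs g [set h | rho (act g (r u)) (act h (r u)) < e / 2].
      have := rho_near (act g (r u)) e2.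
      apply: (@cvg_comp _ _ _ (fun h => (h, r u)) (fun q : G * X => act q.1 q.2)
             (nbhs g) (nbhs (g, r u))); last exact: (ca (g, r u)).
      by apply: cvg_pair; [exact: cvg_id|exact: cvg_cst].
    exists ([set h | rho (act g (r u)) (act h (r u)) < e / 2], [set v | dZ u v < e / 2]).
      by split => /=; [exact: ng|rewrite rK; exact: (metric_nbhs dZ_metric)].
    move=> [h v] /= [gh uv]; apply: eW.
    rewrite -[v]rK actZp dZp.
    have := rhoT (r (p (act g (r u)))) (act g (r u)) (act h (r v)); rewrite rp.
    have := rhoT (act g (r u)) (act h (r u)) (act h (r v)); rewrite rhoA.
    by move: uv; rewrite /dZ; lra.
  + by move=> u; rewrite /actZ a0 rK.
  + by move=> g h u; rewrite /actZ aD -actZp.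
- move=> e e0; exists e => // u v uv g.
  by rewrite /actZ dZp rhop rhoA.
- split => //; first by move=> u; exists (r u).
Qed.

End pseudometric_quotient.

(** * Sections over a fibre of the maximal factor *)

Section maximal_factor.
Context (R : realType) (G : topologicalZmodType) (X : topologicalType)
  (d : X -> X -> R) (act : G -> X -> X)
  (Y : topologicalType) (dY : Y -> Y -> R) (actY : G -> Y -> Y) (pi : X -> Y).
Hypothesis dS : metric_system d act.
Hypothesis aM : minimal act.
Hypothesis piM : max_equicontinuous_factor act dY actY pi.

(** The quotient by [rho] is an equicontinuous factor, so by maximality its map [p] factors through
    [pi]; hence [rho] vanishes on fibres of [pi]. *)
Lemma fibre_section (O : set (X * X)) x y z V : open O ->
  (forall g x z, O (x, z) -> O (act g x, act g z)) ->
  pi x = pi y -> O (x, z) -> nbhs z V -> exists2 z', V z' & O (y, z').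
Proof.
move=> oO Oact pixy Oxz nV; have [cX dM aC] := dS; have [_ a0 aD] := aC.
have [L [LD Lle Lcst Lact]] := @invariant_mean R G X act a0 aD x.
have [rho [rho0 rhoC rhoT rhoA [rho_near rho_sep]]] :=
  section_pseudometric cX aC aM LD Lle Lcst Lact oO Oact dM.
have [Z [dZ [actZ [p [Zs Ze Zf Zp]]]]] :=
  pseudometric_factor cX aC rho0 rhoC rhoT rhoA rho_near.
have [_ _ _ /(_ Z dZ actZ p Zs Ze Zf)[psi [_ psiP]]] := piM.
by apply: (rho_sep x y z V) => //; apply: Zp; rewrite !psiP pixy.
Qed.

End maximal_factor.

Lemma near_forall_ltn (T : Type) (F : set_system T) (P : nat -> T -> Prop) m :
  Filter F -> (forall i, (i < m)%N -> \forall t \near F, P i t) ->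
  \forall t \near F, forall i, (i < m)%N -> P i t.
Proof.
move=> FF; elim: m => [|m ih] FP; first exact: filterE.
have Fm := FP m (ltnSn m).
have /ih Fi : forall i, (i < m)%N -> \forall t \near F, P i t.
  by move=> i im; apply: FP; rewrite ltnW.
apply: filterS2 Fm Fi => t Pm Pi i; rewrite ltnS leq_eqVlt => /predU1P[->//|].
exact: Pi.
Qed.

(** * Moving perturbed fibre tuples into an open set *)

Section fibre_tuples.
Context (R : realType) (G : topologicalZmodType) (X : topologicalType)
  (d : X -> X -> R) (act : G -> X -> X)
  (Y : topologicalType) (dY : Y -> Y -> R) (actY : G -> Y -> Y) (pi : X -> Y).
Hypothesis dS : metric_system d act.
Hypothesis aM : minimal act.
Hypothesis piM : max_equicontinuous_factor act dY actY pi.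

Let aC : continuous_action act. Proof. by have [] := dS. Qed.
Let aYC : continuous_action actY. Proof. by have [[]] := piM. Qed.
Let actC g : continuous (act g). Proof. exact: act_continuous. Qed.

Lemma factor_hit y (U : set Y) : open U -> U !=set0 -> exists g, U (actY g y).
Proof.
have [_ _ [cpi pis piE] _] := piM => oU [u Uu].
have [x <-] := pis y; have [u' u'E] := pis u.
have [||g Ug] := minimal_hit aM x (U := pi @^-1` U).
- by apply: open_comp => // ? _; exact: cpi.
- by exists u'; rewrite /= u'E.
- by exists g; rewrite -piE.
Qed.

(** A finite Baire argument: finitely many translates of the closed set [T] cover [Y]. If [T] had
    empty interior, removing them one at a time would leave a nonempty open set. *)
Lemma factor_semiopen (B : set X) : open B -> B !=set0 ->
  exists2 V : set Y, open V /\ V !=set0 & forall v, V v -> exists2 x, B x & pi x = v.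
Proof.
have [cX dM _] := dS; have [[_ dYM _] _ [cpi pis piE] _] := piM.
move=> oB [b Bb].
have [e e0 eB] := metric_nbhsP dM (open_nbhs_nbhs (conj oB Bb)).
(* The closed ball makes [T] compact, hence closed in [Y]; the radius [e / 2] keeps it inside
   [B]. *)
pose C := [set x | d b x <= e / 2].
pose T := pi @` C.
have cT : closed T.
  apply: compact_closed; first exact: metric_for_hausdorff dYM.
  apply: continuous_compact.
    exact: continuous_subspaceT.
  apply: subclosed_compact (@subsetT _ C) => //.
  apply: (@preimage_closed _ _ (d b) [set r | r <= e / 2]); last exact: closed_le.
  by move=> x _; exact: metric_continuous.
have [l lP] : exists l : seq G, forall y, exists2 g, g \in l & T (actY g y).
  have [||l lP] := minimal_finite_hit aC aM cX (U := [set x | d b x < e / 2]°).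
  - exact: open_interior.
  - by exists b; apply: (metric_nbhs dM); lra.
  exists l => y; have [x <-] := pis y; have [g gl /interior_subset gx] := lP x.
  by exists g => //; exists (act g x); [exact: ltW|rewrite piE].
have [//|nV] := pselect (exists2 V : set Y, open V /\ V !=set0 & V `<=` T).
  move=> [V oV VT]; exists V => // v /VT[x Cx <-]; exists x => //.
  by apply: eB; rewrite /C /= in Cx; lra.
have [V [oV [v Vv] VP]] : exists V : set Y, [/\ open V, V !=set0 &
    forall v g, V v -> g \in l -> ~ T (actY g v)].
  elim: l {lP} => [|g l [V [oV [v Vv] VP]]].
    by exists setT; split => //; [exact: openT|have [x _] := pis (pi b); exists (pi b)].
  exists (V `&` actY g @^-1` (~` T)); split.
  - apply: openI => //; apply: open_comp => [? _|]; last by rewrite openC.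
    exact: act_continuous.
  (* Otherwise the translate of [V] by [g] would be a nonempty open subset of [T]. *)
  - apply: contrapT => nVT; apply: nV; exists (actY (- g) @^-1` V).
      split; first by apply: open_comp => // ? _; exact: act_continuous.
      by exists (actY g v); rewrite /= actK.
    move=> u Vu; apply: contrapT => nTu; apply: nVT; exists (actY (- g) u).
    by split => //=; rewrite actKV.
  - move=> u h [Vu nTu]; rewrite inE => /predU1P[->//|hl].
    exact: VP.
by have [g gl /(VP v g Vv gl)] := lP v.
Qed.

Section simultaneous.
Variable m : nat.
Variable U : set X.
Hypothesis oU : open U.

Let hits (w : nat -> X) := exists g, forall i, (i < m)%N -> U (act g (w i)).

(* The other coordinates are approximated by [act (h i) (w k)]. As [G] is abelian,
   the condition on the tuple [(x, act (h i) x')] is then an invariant open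
   condition on [(x, x')], to which [fibre_section] applies. *)
Lemma fibre_swap (A : nat -> set X) w k z : (k < m)%N -> hits w ->
  (forall i, (i < m)%N -> i != k -> open (A i) /\ A i (w i)) ->
  pi z = pi (w k) ->
  exists w', [/\ hits w', w' k = z &
                 forall i, (i < m)%N -> i != k -> A i (w' i)].
Proof.
move=> km [g0 Ug0] Aw piz; have [_ a0 aD] := aC.
have [h hP] : exists h : nat -> G, forall i, (i < m)%N -> i != k ->
    A i (act (h i) (w k)) /\ U (act g0 (act (h i) (w k))).
  suff /choice[h hP] : forall i, exists g, (i < m)%N -> i != k ->
    A i (act g (w k)) /\ U (act g0 (act g (w k))) by exists h.
  move=> i; have [im|im] := ltnP i m; last by exists 0 => ?; lia.
  have [<-|ik] := eqVneq i k; first by exists 0.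
  have [oA Ai] := Aw i im ik.
  have [||g gP] := minimal_hit aM (w k) (U := A i `&` act g0 @^-1` U).
  - by apply: openI => //; apply: open_comp => // ? _; exact: actC.
  - by exists (w i); split => //; exact: Ug0.
  - by exists g.
pose O := [set q : X * X | exists g, U (act g q.1) /\
  forall i, (i < m)%N -> i != k -> U (act g (act (h i) q.2))].
have [|||||z' Az' [g [Uz Uz']]] := fibre_section dS aM piM (O := O) (x := w k)
  (y := z) (z := w k) (V := [set x | forall i, (i < m)%N -> i != k -> A i (act (h i) x)]).
- rewrite openE => -[x x'] [g [/= Ux Ux']].
  exists (act g @^-1` U, [set x' | forall i, (i < m)%N -> i != k -> U (act g (act (h i) x'))]).
    split => /=; first by apply: actC; exact: open_nbhs_nbhs.
    apply: (near_forall_ltn (F := nbhs x')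
      (P := fun i x' => i != k -> U (act g (act (h i) x')))) => i im /=.
    have [_|ik] := eqVneq i k; first exact: filterE.
    have nU : nbhs (act g (act (h i) x')) U.
      exact: open_nbhs_nbhs (conj oU (Ux' i im ik)).
    have nU' : nbhs x' (act (h i) @^-1` (act g @^-1` U)) by do 2 apply: actC.
    by apply: filterS nU' => ? /= ?.
  by move=> [u u'] [/= ? ?]; exists g.
(* Invariance of [O]: [g - a] undoes the translation, once [a] is commuted past [h i]. *)
- move=> a x x' [g [/= Ux Ux']]; exists (g - a); split => /=.
    by rewrite -aD subrK.
  by move=> i im ik; rewrite -!aD -addrA [h i + a]addrC addrA subrK aD; exact: Ux'.
- by rewrite piz.
- exists g0; split => [|i im ik] /=; first exact: Ug0.
  by have [] := hP i im ik.
- apply: (near_forall_ltn (P := fun i x => i != k -> A i (act (h i) x))) => i im.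
  have [_|ik] := eqVneq i k; first exact: filterE.
  have [oA Ai] := Aw i im ik; have [Ah _] := hP i im ik.
  have nA : nbhs (w k) (act (h i) @^-1` A i).
    exact/actC/(open_nbhs_nbhs (conj oA Ah)).
  by apply: filterS nA => ? /= ?.
exists (fun i => if i == k then z else act (h i) z'); split.
- exists g => i im; case: eqVneq => // ik; exact: Uz'.
- by rewrite eqxx.
- by move=> i im ik; rewrite (negbTE ik); exact: Az'.
Qed.

(* Semi-openness of [pi] on [U] and on the [W i] gives [w0 i] in [U] (up to one
   translation) lying over points of [W i]; the coordinates of [w0] are then
   swapped one at a time into the [W i]. *)
Lemma fibre_hits (x : nat -> X) y (W : nat -> set X) :
  U !=set0 -> (forall i, (i < m)%N -> [/\ pi (x i) = y, open (W i) & W i (x i)]) ->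
  exists2 w, hits w & forall i, (i < m)%N -> W i (w i).
Proof.
move=> U0 xP; have [_ _ [cpi pis piE] _] := piM; have [_ a0 aD] := aC.
have [V0 [oV0 V00] V0P] := factor_semiopen oU U0.
have [g Vg] := factor_hit y oV0 V00.
pose V := actY g @^-1` V0.
(* Points over [V] share their image with a point that [g] sends into [U]; this gives the starting
   tuple [w0]. *)
pose W' i := W i `&` pi @^-1` V.
have oV : open V by apply: open_comp => // ? _; exact: act_continuous.
have oW' i : (i < m)%N -> open (W' i).
  move=> /xP[_ oW _]; apply: openI => //.
  by apply: open_comp => // ? _; exact: cpi.
have [S SP] : exists S : nat -> set Y, forall i, (i < m)%N ->
    [/\ open (S i), S i !=set0 & forall v, S i v -> exists2 x, W' i x & pi x = v].
  suff /choice[S SP] : forall i, exists S : set Y, (i < m)%N ->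
    [/\ open S, S !=set0 & forall v, S v -> exists2 x, W' i x & pi x = v] by exists S.
  move=> i; have [im|im] := ltnP i m; last by exists setT => ?; lia.
  have [|S [oS S0] SP] := factor_semiopen (oW' i im); last by exists S.
  by have [xy _ Wx] := xP i im; exists (x i); split => //; rewrite /= xy.
pose A i := act g @^-1` U `&` pi @^-1` S i.
have oA i : (i < m)%N -> open (A i).
  move=> /SP[oS _ _].
  by apply: openI; (apply: open_comp => //) => ? _; (exact: actC || exact: cpi).
have [w0 w0P] : exists w0 : nat -> X, forall i, (i < m)%N -> A i (w0 i).
  suff /choice[w0 w0P] : forall i, exists a, (i < m)%N -> A i a by exists w0.
  move=> i; have [im|im] := ltnP i m; last by exists (x 0%N) => ?; lia.
  have [_ [v Sv] /(_ v Sv)[u [_ Vu] uv]] := SP i im.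
  have [a Ua aE] := V0P _ Vu.
  exists (act (- g) a) => _; split; first by rewrite /= actKV.
  by rewrite /= piE aE actK // uv.
suff [w [hw Ww _]] : exists w, [/\ hits w, forall i, (i < m)%N -> (i < m)%N -> W' i (w i)
    & forall i, (i < m)%N -> (m <= i)%N -> A i (w i)].
  by exists w => // i im; have [] := Ww i im im.
(* Induction on the number of coordinates already moved into [W' i]; the others wait in [A i], whose
   image lies in [S i]. *)
suff claim k : (k <= m)%N -> exists w, [/\ hits w,
    forall i, (i < m)%N -> (i < k)%N -> W' i (w i)
    & forall i, (i < m)%N -> (k <= i)%N -> A i (w i)] by exact: claim.
elim: k => [_|k ih km].
  exists w0; split => //; last by move=> i im _; exact: w0P.
  by exists g => i /w0P[].
have [w [hw Ww Aw]] := ih (ltnW km).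
have [_ Skw] := Aw k km (leqnn k).
(* The fibre of [w k] contains a point [z] of [W' k], which becomes the new coordinate. *)
have [_ _ /(_ _ Skw)[z Wz piz]] := SP k km.
have [|w' [hw' w'k w'P]] :=
    fibre_swap (A := fun i => if (i < k)%N then W' i else A i) km hw _ piz.
  move=> i im ik; case: ltnP => ki; split; [exact: oW'|exact: Ww|exact: oA|exact: Aw].
exists w'; split => // i im.
  rewrite ltnS leq_eqVlt => /predU1P[->|ik]; first by rewrite w'k.
  by have := w'P i im; rewrite ik; apply; rewrite ltn_eqF.
by move=> ki; have := w'P i im; rewrite ltnNge (ltnW ki) /=; apply; rewrite gtn_eqF.
Qed.

End simultaneous.
End fibre_tuples.

(** * Distances in the limit and proximality *)

Lemma metric_cvg_le (R : realType) (X : topologicalType) (d : X -> X -> R)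
    (I : Type) (F : set_system I) (f g : I -> X) a b c :
  metric_for d -> ProperFilter F -> f @ F --> a -> g @ F --> b ->
  (\forall i \near F, c <= d (f i) (g i)) -> c <= d a b.
Proof.
move=> dM FF fa gb cF; have [_ _ dC dT _] := dM.
rewrite leNgt; apply/negP => abc.
have e0 : 0 < (c - d a b) / 2 by lra.
have Ff : \forall i \near F, d a (f i) < (c - d a b) / 2.
  exact: fa (metric_nbhs dM a e0).
have Fg : \forall i \near F, d b (g i) < (c - d a b) / 2.
  exact: gb (metric_nbhs dM b e0).
have [i [[/= fi gi] ci]] := filter_ex (filterI (filterI Ff Fg) cF).
have := dT (f i) a (g i); have := dT a b (g i); rewrite (dC (f i) a); lra.
Qed.

Lemma metric_uniform_continuous (R : realType) (X Y : topologicalType)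
    (d : X -> X -> R) (dY : Y -> Y -> R) (f : X -> Y) e :
  compact [set: X] -> metric_for d -> metric_for dY -> continuous f -> 0 < e ->
  exists2 del, 0 < del & forall x y, d x y < del -> dY (f x) (f y) < e.
Proof.
move=> /compact_near_coveringP cX dM dYM cf e0.
have [_ _ dC dT _] := dM; have [_ _ dYC dYT _] := dYM.
have : \forall del \near 0^'+, [set: X] `<=` fun x => forall y, d x y < del ->
    dY (f x) (f y) < e.
  apply: cX => x _.
  have e2 : 0 < e / 2 by lra.
  have [r r0 rP] := metric_nbhsP dM (cf x _ (metric_nbhs dYM (f x) e2)).
  have r2 : 0 < r / 2 by lra.
  exists ([set x' | d x x' < r / 2], [set s : R | s < r / 2]).
    by split; [exact: metric_nbhs|exact: nbhs_right_lt].
  move=> [x' s] /= [xx' sr] y x'y.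
  have /= h1 : dY (f x) (f x') < e / 2 by apply: rP; lra.
  have /= h2 : dY (f x) (f y) < e / 2.
    by apply: rP; have := dT x x' y; lra.
  by have := dYT (f x') (f x) (f y); rewrite (dYC (f x') (f x)); lra.
move=> delP.
have [del [del0 delX]] := filter_ex (filterI (nbhs_right_gt (0 : R)) delP).
by exists del => // x y; exact: delX.
Qed.

Section orbit_inf_dist.
Context (R : realType) (G : topologicalZmodType) (X : topologicalType)
  (d : X -> X -> R) (act : G -> X -> X).
Hypothesis dM : metric_for d.

Lemma orbit_inf_dist_le x y g : orbit_inf_dist d act x y <= d (act g x) (act g y).
Proof.
have [d0 _ _ _ _] := dM; apply: ge_inf; last by exists g.
by exists 0 => _ [h _ <-].
Qed.

Lemma orbit_inf_dist_ge x y c : (forall g, c <= d (act g x) (act g y)) ->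
  c <= orbit_inf_dist d act x y.
Proof.
move=> h; apply: lb_le_inf; first by exists (d (act 0 x) (act 0 y)), 0.
by move=> _ [g _ <-].
Qed.

Lemma non_proximalP x y :
  ~ proximal d act x y <-> 0 < orbit_inf_dist d act x y.
Proof.
have [d0 _ _ _ _] := dM; rewrite /proximal; split; last by move=> + h; rewrite h ltxx.
move=> /eqP; rewrite lt_neqAle eq_sym => -> /=.
by apply: orbit_inf_dist_ge.
Qed.

End orbit_inf_dist.

(** * The three implications *)

Section characterisation.
Context (R : realType) (G : topologicalZmodType) (X : topologicalType)
  (d : X -> X -> R) (act : G -> X -> X)
  (Y : topologicalType) (dY : Y -> Y -> R) (actY : G -> Y -> Y) (pi : X -> Y).
Hypothesis dS : metric_system d act.
Hypothesis aM : minimal act.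

Let cX : compact [set: X]. Proof. by have [] := dS. Qed.
Let dM : metric_for d. Proof. by have [] := dS. Qed.
Let aC : continuous_action act. Proof. by have [] := dS. Qed.

(** Joint continuity gives the estimate near each [k], and compactness of [K] makes it uniform. *)
Lemma act_compact_nbhs (K : set G) x e : compact K -> 0 < e ->
  nbhs x [set w | forall k, K k -> d (act k x) (act k w) < e].
Proof.
move=> /compact_near_coveringP cK e0; have [ca _ _] := aC.
have [_ _ dC dT _] := dM.
apply: (cK X (nbhs x) (fun w k => d (act k x) (act k w) < e)) => k _.
have e2 : 0 < e / 2 by lra.
have [[P Q] [/= nP nQ] PQ] := ca (k, x) _ (metric_nbhs dM (act k x) e2).
exists (P, Q) => // -[k' w] [/= Pk' Qw].
have /= h1 := PQ (k', w) (conj Pk' Qw).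
have /= h2 := PQ (k', x) (conj Pk' (nbhs_singleton nQ)).
by have := dT (act k' x) (act k x) (act k' w); rewrite (dC (act k' x) (act k x)); lra.
Qed.

Lemma regionally_proximal_act g x y : regionally_proximal d act x y ->
  regionally_proximal d act (act g x) (act g y).
Proof.
move=> xy e e0; have [_ _ aD] := aC.
have near_act z : exists2 r, 0 < r & forall z', d z z' < r -> d (act g z) (act g z') < e.
  apply: (metric_nbhsP dM).
  exact: (act_continuous aC (g := g) (metric_nbhs dM (act g z) e0)).
have [r r0 rP] := near_act x; have [s s0 sP] := near_act y.
have t0 : 0 < Num.min e (Num.min r s) by rewrite !lt_min e0 r0 s0.
have [x' [y' [a []]]] := xy _ t0.
rewrite !lt_min => /and3P[_ xr _] /and3P[_ _ ys] /and3P[axy _ _].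
exists (act g x'), (act g y'), (a - g); split; [exact: rP|exact: sP|].
by rewrite -!aD subrK.
Qed.

Lemma sensitive_regionally_proximal m : sigma_compact G -> (2 <= m)%N ->
  compactly_sensitive d act m ->
  exists2 del : R, 0 < del &
    forall U : set X, open U -> U !=set0 -> exists x : nat -> X,
      [/\ U (x 0%N),
          forall i j, (i < m)%N -> (j < m)%N ->
            regionally_proximal d act (x i) (x j) &
          forall i j, (i < m)%N -> (j < m)%N -> i != j ->
            del < orbit_inf_dist d act (x i) (x j)].
Proof.
move=> [K [cK KG]] m2 [eps eps0 sens]; exists (eps / 2); first by lra.
move=> U oU U0.
have [u0 _] := U0.
have [_ a0 aD] := aC; have [_ _ dC dT _] := dM.
(* The sets [V n] shrink to [u0], while each element of [G] lies in [Kn n] for all large [n]. *)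
pose V n := [set x | d u0 x < n.+1%:R^-1]°.
pose Kn n := \big[setU/set0]_(i < n.+1) K i.
have /choice[q qP] : forall n, exists q : (nat -> X) * G,
    (forall i, (i < m)%N -> V n (q.1 i)) /\
    (forall k, Kn n k -> forall i j, (i < m)%N -> (j < m)%N -> i != j ->
      eps < d (act (k + q.2) (q.1 i)) (act (k + q.2) (q.1 j))).
  move=> n; have V0 : V n !=set0 by exists u0; exact: metric_nbhs.
  have cKn : compact (Kn n) by exact: bigsetU_compact.
  have [x [h xh]] := sens (V n) (@open_interior _ _) V0 (Kn n) cKn.
  by exists (x, h).
(* One ultrafilter gives limits of all coordinates at once, without extracting subsequences. *)
have [F [FU Foo]] := ultraFilterLemma eventually_filter.
pose p i n := act (q n).2 ((q n).1 i).
have /choice[z zP] : forall i : nat, exists z : X, p i @ F --> z.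
  move=> i; have [z _ pz] := ultra_cvg_compact (f := p i) FU cX (fun=> I).
  by exists z.
have sep g i j : (i < m)%N -> (j < m)%N -> i != j ->
    eps <= d (act g (z i)) (act g (z j)).
  move=> im jm ij.
  apply: (@metric_cvg_le _ _ _ _ F (act g \o p i) (act g \o p j)) => //.
  - by apply: continuous_cvg (zP i); exact: act_continuous.
  - by apply: continuous_cvg (zP j); exact: act_continuous.
  have [N _ KN] : (\bigcup_n K n) g by rewrite KG.
  apply: Foo; exists N => // n /= Nn; rewrite -!aD; apply/ltW.
  have [_ sepn] := qP n; apply: sepn => //.
  by rewrite /Kn -bigcup_mkord; exists N.
have prox i j : (i < m)%N -> (j < m)%N -> regionally_proximal d act (z i) (z j).
  move=> im jm e e0.
  have Fz k : \forall n \near F, d (z k) (p k n) < e.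
    exact: zP (metric_nbhs dM (z k) e0).
  have e2 : 0 < e / 2 by lra.
  have Fn : \forall n \near F, n.+1%:R^-1 < e / 2.
    exact/Foo/(near_infty_natSinv_lt (PosNum e2)).
  have [n [/= [zi zj] ne]] := filter_ex (filterI (filterI (Fz i) (Fz j)) Fn).
  (* Undoing the translation returns both points to [V n], at distance less than [2 / n.+1] from
     each other. *)
  exists (p i n), (p j n), (- (q n).2); split => //.
  rewrite /p !actK //; have [Vn _] := qP n.
  have /interior_subset /lt_trans/(_ ne) := Vn i im.
  have /interior_subset /lt_trans/(_ ne) := Vn j jm.
  have := dT ((q n).1 i) u0 ((q n).1 j); rewrite (dC _ u0); lra.
(* The limit tuple need not meet [U]; translating it brings [z 0] into [U] and preserves the other
   properties. *)
have [g Ug] := minimal_hit aM (z 0%N) oU U0.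
exists (fun i => act g (z i)); split => // i j im jm.
  exact/regionally_proximal_act/prox.
move=> ij; rewrite (@lt_le_trans _ _ eps)//; first by lra.
by apply: (orbit_inf_dist_ge) => h; rewrite -!aD; exact: sep.
Qed.

Hypothesis piM : max_equicontinuous_factor act dY actY pi.

(** Equicontinuity on [Y] applied to [- g] shows that points brought together at time [g] already
    had close images; continuity of [pi] passes from [x'], [y'] to [x], [y]. *)
Lemma regionally_proximal_fibre x y : regionally_proximal d act x y -> pi x = pi y.
Proof.
have [[_ dYM aYC] eqY [cpi pis piE] _] := piM; have [d0 dE dYC dYT _] := dYM.
move=> xy; apply/dE/eqP; rewrite eq_le d0 andbT leNgt; apply/negP => c0.
have c3 : 0 < dY (pi x) (pi y) / 3 by lra.
have [r r0 rP] := eqY _ c3.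
have [s s0 sP] := metric_uniform_continuous cX dM dYM cpi r0.
have [t t0 tP] := metric_uniform_continuous cX dM dYM cpi c3.
have e0 : 0 < Num.min s t by rewrite lt_min s0 t0.
have [x' [y' [g []]]] := xy _ e0.
rewrite !lt_min => /andP[_ /tP h1] /andP[_ /tP h2] /andP[/sP + _].
rewrite !piE => /rP /(_ (- g)); rewrite !actK// => h3.
have := dYT (pi x) (pi x') (pi y); have := dYT (pi x') (pi y') (pi y).
by rewrite (dYC (pi y')); lra.
Qed.

Lemma regionally_proximal_coincidence m : (2 <= m)%N ->
  (exists2 del : R, 0 < del &
    forall U : set X, open U -> U !=set0 -> exists x : nat -> X,
      [/\ U (x 0%N),
          forall i j, (i < m)%N -> (j < m)%N ->
            regionally_proximal d act (x i) (x j) &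
          forall i j, (i < m)%N -> (j < m)%N -> i != j ->
            del < orbit_inf_dist d act (x i) (x j)]) ->
  coincidence_rank_ge d act pi m.
Proof.
move=> m2 [del del0 h] y; exists m; split => //.
have [[_ dYM aYC] eqY [cpi pis piE] _] := piM; have [_ _ aD] := aC.
have [x0 _] := pis y.
(* A single tuple suffices: it lies in one fibre, and limits of its translates reach the fibre over
   any [y], keeping the bound [del] at all times. *)
have [||x [_ xQ xd]] := h setT; [exact: openT|by exists x0|].
have xpi i : (i < m)%N -> pi (x i) = pi (x 0%N).
  by move=> im; apply: regionally_proximal_fibre; apply: xQ => //; lia.
have /choice[g gP] : forall n, exists g, dY y (actY g (pi (x 0%N))) < n.+1%:R^-1.
  move=> n; have [||g /interior_subset gP] := factor_hit aM piM (pi (x 0%N))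
    (U := [set v | dY y v < n.+1%:R^-1]°).
  - exact: open_interior.
  - by exists y; apply: (metric_nbhs dYM).
  - by exists g.
have [F [FU Foo]] := ultraFilterLemma eventually_filter.
have /choice[z zP] : forall i : nat, exists z : X, act (g n) (x i) @[n --> F] --> z.
  move=> i; have [z _ pz] :=
    ultra_cvg_compact (f := fun n => act (g n) (x i)) FU cX (fun=> I).
  by exists z.
exists z; split=> [i im|i j im jm ij].
  have gy : actY (g n) (pi (x 0%N)) @[n --> F] --> y.
    move=> W /(metric_nbhsP dYM)[e e0 eW].
    have Fn : \forall n \near F, n.+1%:R^-1 < e.
      exact/Foo/(near_infty_natSinv_lt (PosNum e0)).
    by apply: filterS Fn => n ne; apply: eW; exact: lt_trans ne.
  have gz : actY (g n) (pi (x 0%N)) @[n --> F] --> pi (z i).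
    rewrite -(xpi i im).
    have -> : (fun n => actY (g n) (pi (x i))) = pi \o (fun n => act (g n) (x i)).
      by apply/funext => n /=; rewrite piE.
    by apply: continuous_cvg (zP i); exact: cpi.
  exact: (cvg_unique (metric_for_hausdorff dYM) gz gy).
apply/(non_proximalP _ dM)/(lt_le_trans del0)/(orbit_inf_dist_ge) => a.
apply: (@metric_cvg_le _ _ _ _ F (act a \o (fun n => act (g n) (x i)))
  (act a \o (fun n => act (g n) (x j)))) => //.
- by apply: continuous_cvg (zP i); exact: act_continuous.
- by apply: continuous_cvg (zP j); exact: act_continuous.
apply: filterE => n /=; rewrite -!aD.
by rewrite (le_trans (ltW (xd i j im jm ij)))//; exact: orbit_inf_dist_le.
Qed.

Lemma coincidence_sensitive m : coincidence_rank_ge d act pi m ->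
  compactly_sensitive d act m.
Proof.
move=> rk; have [_ a0 aD] := aC; have [_ _ dC dT _] := dM.
have [[x0 _]|X0] := pselect ([set: X] !=set0); last first.
  by exists 1 => // U _ [u _]; case: X0; exists u.
have [n [mn [x [xy xnp]]]] := rk (pi x0).
have xpos i j : (i < m)%N -> (j < m)%N -> i != j ->
    0 < orbit_inf_dist d act (x i) (x j).
  by move=> im jm ij; apply/(non_proximalP _ dM)/xnp => //; lia.
have near_e : \forall e \near (0 : R)^'+, forall i, (i < m)%N -> forall j, (j < m)%N ->
    i != j -> e < orbit_inf_dist d act (x i) (x j).
  apply: near_forall_ltn => i im; apply: near_forall_ltn => j jm.
  have [_|ij] := eqVneq i j; first exact: filterE.
  have := nbhs_right_lt (xpos i j im jm ij).
  by apply: filterS => e /= ?.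
(* One [e] lies below the finitely many orbit infima; two perturbations of size [e / 3] then leave
   [e / 3]. *)
have [e [e0 eP]] := filter_ex (filterI (nbhs_right_gt (0 : R)) near_e).
rewrite /= in e0; have e3 : 0 < e / 3 by lra.
exists (e / 3) => // U oU U0 K cK.
pose W i := [set w | forall k, K k -> d (act k (x i)) (act k w) < e / 3]°.
have [|w [g Ug] Ww] := fibre_hits dS aM piM (m := m) (y := pi x0) (x := x) (W := W) oU U0.
  move=> i im; split; [by apply: xy; lia|exact: open_interior|].
  exact: act_compact_nbhs.
(* The points in [U] are [act g (w i)], so [k - g] sends them to [act k (w i)], which is close to
   [act k (x i)]. *)
exists (fun i => act g (w i)), (- g); split => // k Kk i j im jm ij.
rewrite -!aD !subrK.
have /interior_subset /(_ k Kk) wi := Ww i im.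
have /interior_subset /(_ k Kk) wj := Ww j jm.
have := orbit_inf_dist_le act dM (x i) (x j) k; have := eP i im j jm ij.
have := dT (act k (x i)) (act k (w i)) (act k (x j)).
have := dT (act k (w i)) (act k (w j)) (act k (x j)).
by rewrite (dC (act k (w j)) (act k (x j))); lra.
Qed.

End characterisation.

Theorem theorem5p5 (R : realType) (G : topologicalZmodType) (X : topologicalType)
    (d : X -> X -> R) (act : G -> X -> X)
    (Y : topologicalType) (dY : Y -> Y -> R) (actY : G -> Y -> Y) (pi : X -> Y)
    (m : nat) :
  locally_compact [set: G] -> sigma_compact G ->
  metric_system d act -> minimal act ->
  max_equicontinuous_factor act dY actY pi -> (2 <= m)%N ->
  [<-> compactly_sensitive d act m;
       exists2 del : R, 0 < del &
         forall U : set X, open U -> U !=set0 ->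
         exists x : nat -> X,
           [/\ U (x 0%N),
               (forall i j, (i < m)%N -> (j < m)%N ->
                  regionally_proximal d act (x i) (x j)) &
               (forall i j, (i < m)%N -> (j < m)%N -> i != j ->
                  del < orbit_inf_dist d act (x i) (x j))];
       coincidence_rank_ge d act pi m].
Proof.
move=> _ sG dS aM piM m2; tfae.
- exact: (sensitive_regionally_proximal dS aM sG m2).
- exact: (regionally_proximal_coincidence dS aM piM m2).
- exact: (coincidence_sensitive dS aM piM).
Qed.
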